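(* Suppose $\ell(t,x,u)=\sum_{k=1}^K\ell_k(t,x_{N_k},u_{M_k})$ and $f_{S_k}(t,x,u)=f_k(t,x_{N_k},u_{M_k})$ for every $k$. Let $v^\star=\sum_{k=1}^Kv_k^\star(t,x_{S_k})$, $v_k^\star\in C^1([t_0,T]\times X_{S_k})$, be a globally feasible block-additive OM-dual certificate. Suppose that, for every $\eta>0$, each block admits an approximation $\tilde v_{k,\eta}\in\mathcal U_k^{(r_k(\eta))}$ satisfying $$\sup_Z|A_k(\tilde v_{k,\eta}-v_k^\star)|\le\eta,\qquad\sup_{X_{S_k}}|\tilde v_{k,\eta}(T,\cdot)-v_k^\star(T,\cdot)|\le\eta.$$ Then, for every $\eta>0$, $\tilde v_\eta:=\sum_{k=1}^K\tilde v_{k,\eta}$ is $(K\eta,K\eta)$-feasible. Hence it yields the certified lower bound $$\langle\tilde v_\eta(t_0,\cdot),\mu_0\rangle-(T-t_0)\mu_0(X)K\eta-\mu_0(X)K\eta\le P,$$ and $\tilde v_\eta$ uses $r_{\mathrm{tot}}(\eta)=\sum_{k=1}^Kr_k(\eta)$ coefficients.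
   Context: Setting. $t_0<T$, $X\subseteq\mathbb R^n$, $U\subseteq\mathbb R^m$, $Z:=[t_0,T]\times X\times U$, dynamics $f:Z\to\mathbb R^n$, running cost $\ell:Z\to\mathbb R$, terminal cost $g:X\to\mathbb R$. $\mathcal M_+(\cdot)$ denotes finite nonnegative Borel measures, $\langle\phi,\rho\rangle:=\int\phi\,d\rho$, and $\mu_0\in\mathcal M_+(\{t_0\}\times X)$ is fixed; measures on $\{t_0\}\times X$ and $\{T\}\times X$ are identified with measures on $X$. For $v\in C^1([t_0,T]\times X)$, $(L_fv)(t,x,u):=\partial_tv(t,x)+\nabla_xv(t,x)^\top f(t,x,u)$. All pairings appearing are assumed well-defined and finite. The occupation-measure (OM) LP value is $$P:=\inf\{\langle\ell,\mu\rangle+\langle g,\mu_T\rangle:\ \mu\in\mathcal M_+(Z),\ \mu_T\in\mathcal M_+(\{T\}\times X),\ \langle v,\mu_T-\mu_0\rangle=\langle L_fv,\mu\rangle\ \forall v\in C^1([t_0,T]\times X)\}.$$ $v\in C^1([t_0,T]\times X)$ is $(\varepsilon,\varepsilon_T)$-feasible if $\ell+L_fv\ge-\varepsilon$ on $Z$ and $g-v(T,\cdot)\ge-\varepsilon_T$ on $X$; it is a globally feasible OM-dual certificate if it is $(0,0)$-feasible. Index sets: $S_k\subseteq\{1,\dots,n\}$ ($k=1,\dots,K$), $S_k\subseteq N_k\subseteq\{1,\dots,n\}$, $M_k\subseteq\{1,\dots,m\}$. $x_S$, $u_M$, $f_S$ denote subvectors; $X_S$ is the projection of $X$ onto the coordinates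 in $S$. For $\phi\in C^1([t_0,T]\times X_{S_k})$, $A_k\phi:=\partial_t\phi(t,x_{S_k})+\nabla_{x_{S_k}}\phi(t,x_{S_k})^\top f_k(t,x_{N_k},u_{M_k})$. $\mathcal U_k^{(r)}\subset C^1([t_0,T]\times X_{S_k})$ denotes a family of functions parameterized by $r$ real coefficients. *)

(* Defs.v *)
(* MathComp + MathComp-Analysis; the reals are an arbitrary [R : realType]. *)
From HB Require Import structures.
From mathcomp Require Import all_boot all_order all_algebra.
From mathcomp Require Import all_classical all_reals all_analysis.
Set Implicit Arguments.
Unset Strict Implicit.
Unset Printing Implicit Defensive.
Import Order.TTheory GRing.Theory Num.Theory.
Import numFieldNormedType.Exports.
Local Open Scope classical_set_scope.
Local Open Scope ring_scope.

Section BorelSubspace.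
Variables (R : realType) (V : normedModType R) (A : set V).

Definition open_traces : set (set V) :=
  [set B | exists2 O, open O & A `&` B = A `&` O].

(* Measurable types of the library are pointed, so the subspace A (possibly
   empty, possibly not Borel in V) is not represented by a subtype: the carrier
   is V, a set is measurable iff its trace on A is Borel in the subspace A
   (lemma [borel_onP]), and the values of a function outside A are irrelevant
   to its measurability. *)
Definition borel_on := g_sigma_algebraType open_traces.

Lemma borel_onP (B : set V) :
  open_traces.-sigma.-measurable B <->
  exists2 C, <<s (@open V) >> C & A `&` B = A `&` C.
Proof.
split.
- pose G := [set B | exists2 C, <<s (@open V) >> C & A `&` B = A `&` C].
  suff : <<s open_traces >> `<=` G by exact.
  apply: smallest_sub.
    split.
    + by exists set0 => //; exact: sigma_algebra0.
    + move=> E [C sC AEC]; exists (setT `\` C); first exact: sigma_algebraCD.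
      apply/seteqP; split=> x [Ax [_ nx]]; split => //; split => // Ex; apply: nx.
        have : (A `&` C) x by [].
        by rewrite -AEC => -[].
      have : (A `&` E) x by [].
      by rewrite AEC => -[].
    + move=> F GF; have /choice[C hC] : forall i, exists C,
          <<s (@open V) >> C /\ A `&` F i = A `&` C.
        by move=> i; have [C sC AFC] := GF i; exists C.
      exists (\bigcup_i C i).
        by apply: sigma_algebra_bigcup => i; have [] := hC i.
      rewrite !setI_bigcupr; apply: eq_bigcupr => i _.
      by have [] := hC i.
  by move=> E [W oW AEW]; exists W => //; exact: sub_sigma_algebra.
- move=> [C sC ABC].
  have mC : open_traces.-sigma.-measurable C.
    move: sC; apply: smallest_sub; first exact: smallest_sigma_algebra.
    by move=> O oO; apply: sub_sigma_algebra; exists O.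
  have mN E : A `&` E = set0 -> open_traces.-sigma.-measurable E.
    move=> AE; apply: sub_sigma_algebra.
    by exists set0; [exact: open0 | rewrite setI0].
  have mA : open_traces.-sigma.-measurable A.
    by rewrite -[A]setCK; apply: measurableC; apply: mN; rewrite setICr.
  rewrite -[B]setIT -(setUv A) setIUr (setIC B A) ABC.
  apply: measurableU; first exact: measurableI.
  by apply: mN; rewrite setICA setICr setI0.
Qed.

(* An element of M_+(A) is a finite measure on [borel_on] concentrated on A. *)
Definition concentrated (mu : {finite_measure set borel_on -> \bar R}) :=
  mu (~` A) = 0%E.

End BorelSubspace.

Section C1.
Variables (R : realType) (p : nat).
Implicit Types (D : set (R * 'rV[R]_p)) (v : R * 'rV[R]_p -> R).

(* C^1(D) for an arbitrary set D: functions that are C^1 on some open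
   neighbourhood of D. Elements are total functions; only their germs along D
   matter, and derivatives at points of D are those of this extension. *)
Definition C1_on D v := exists O : set (R * 'rV[R]_p),
  [/\ open O, D `<=` O, (forall z, O z -> differentiable v z) &
      forall h z, O z -> {for z, continuous (fun y => 'D_h v y)}].

Definition dt v (z : R * 'rV[R]_p) : R := 'D_((1, 0) : R * 'rV[R]_p) v z.

Definition grad_x v (z : R * 'rV[R]_p) : 'rV[R]_p :=
  \row_i 'D_((0, delta_mx 0 i) : R * 'rV[R]_p) v z.

(* d_t v + (nabla_x v)^T w at the point z *)
Definition transport v (z : R * 'rV[R]_p) (w : 'rV[R]_p) : R :=
  dt v z + (grad_x v z *m w^T) 0 0.

End C1.

Section Subvectors.
Variables (R : realType).

Definition subvec n (S : {set 'I_n}) (x : 'rV[R]_n) : 'rV[R]_#|S| :=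
  colsub (@enum_val _ (mem S)) x.

Definition subtx n (S : {set 'I_n}) (z : R * 'rV[R]_n) : R * 'rV[R]_#|S| :=
  (z.1, subvec S z.2).

Definition subtxu n m (N : {set 'I_n}) (M : {set 'I_m})
    (z : R * 'rV[R]_n * 'rV[R]_m) : R * 'rV[R]_#|N| * 'rV[R]_#|M| :=
  (z.1.1, subvec N z.1.2, subvec M z.2).

End Subvectors.

Section OccupationMeasureLP.
Variables (R : realType) (n m : nat) (t0 T : R).
Variables (X : set 'rV[R]_n) (U : set 'rV[R]_m).
Variables (f : R * 'rV[R]_n * 'rV[R]_m -> 'rV[R]_n).
Variables (ell : R * 'rV[R]_n * 'rV[R]_m -> R) (g : 'rV[R]_n -> R).

Definition timeX p (Y : set 'rV[R]_p) : set (R * 'rV[R]_p) :=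
  [set` `[t0, T]] `*` Y.

Definition Zset : set (R * 'rV[R]_n * 'rV[R]_m) := timeX X `*` U.

Definition Lie (v : R * 'rV[R]_n -> R) (z : R * 'rV[R]_n * 'rV[R]_m) : R :=
  transport v z.1 (f z).

Definition dual_feasible (eps epsT : R) (v : R * 'rV[R]_n -> R) :=
  [/\ C1_on (timeX X) v,
      (forall z, Zset z -> ell z + Lie v z >= - eps) &
      (forall x, X x -> g x - v (T, x) >= - epsT)].

Definition dual_certificate := dual_feasible 0 0.

(* Measures on {t0} x X and {T} x X are identified with measures on X. The
   feasible pairs are those for which all pairings are well-defined and finite,
   i.e. the integrands are integrable. *)
Definition OM_feasible (mu0 : {finite_measure set (borel_on X) -> \bar R})
    (mu : {finite_measure set (borel_on Zset) -> \bar R})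
    (muT : {finite_measure set (borel_on X) -> \bar R}) :=
  [/\ concentrated mu /\ concentrated muT,
      mu.-integrable Zset (EFin \o ell),
      muT.-integrable X (EFin \o g) &
      forall v, C1_on (timeX X) v ->
        [/\ mu.-integrable Zset (EFin \o Lie v),
            muT.-integrable X (fun x => (v (T, x))%:E) &
            (\int[muT]_(x in X) (v (T, x))%:E
               - \int[mu0]_(x in X) (v (t0, x))%:E
             = \int[mu]_(z in Zset) (Lie v z)%:E)%E]].

Definition OM_value (mu0 : {finite_measure set (borel_on X) -> \bar R}) :
    \bar R :=
  ereal_inf [set c | exists mu muT, OM_feasible mu0 mu muT /\
    c = (\int[mu]_(z in Zset) (ell z)%:E + \int[muT]_(x in X) (g x)%:E)%E].

End OccupationMeasureLP.

Section Blocks.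
Variables (R : realType) (n m K : nat).
Variables (S N : 'I_K -> {set 'I_n}) (M : 'I_K -> {set 'I_m}).

Definition block_sum (v : forall k, R * 'rV[R]_#|S k| -> R)
    (z : R * 'rV[R]_n) : R := \sum_(k < K) v k (subtx (S k) z).

(* A_k phi, as a function of z = (t, x, u) *)
Definition block_op
    (fb : forall k, R * 'rV[R]_#|N k| * 'rV[R]_#|M k| -> 'rV[R]_#|S k|)
    (k : 'I_K) (phi : R * 'rV[R]_#|S k| -> R)
    (z : R * 'rV[R]_n * 'rV[R]_m) : R :=
  transport phi (subtx (S k) z.1) (fb k (subtxu (N k) (M k) z)).

(* [par k r] maps r real coefficients to a function, U_k^(r) is its range.
   The sum of one such function per block is parameterized by the concatenated
   coefficient vector, of length \sum_k r k. *)
Definition sum_par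
    (par : forall (k : 'I_K) (r : nat), 'rV[R]_r -> R * 'rV[R]_#|S k| -> R)
    (r : 'I_K -> nat) (c : 'rV[R]_(\sum_(k < K) r k)) : R * 'rV[R]_n -> R :=
  block_sum (fun k => par k (r k) (submxrow c k)).

End Blocks.

(* Main.v *)
(* Integrating the two relaxed dual inequalities against an arbitrary feasible
   pair (mu, mu_T) and using the Liouville equation for v bounds its cost below by
   <v(t0, .), mu_0> - eps mu(Z) - eps_T mu_T(X). The masses are determined by the
   test functions 1 and t: mu_T(X) = mu_0(X) and mu(Z) = (T - t0) mu_0(X).
   Feasibility of the approximate certificate is blockwise: on Z, L_f of a block
   sum is the sum of the A_k by the chain rule for the coordinate projections, so
   each block costs at most eta in either inequality. *)
Require Import Defs.
From HB Require Import structures.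
From mathcomp Require Import all_boot all_order all_algebra lra.
From mathcomp Require Import all_classical all_reals all_analysis.
Set Implicit Arguments.
Unset Strict Implicit.
Unset Printing Implicit Defensive.
Import Order.TTheory GRing.Theory Num.Theory.
Import numFieldNormedType.Exports.
Local Open Scope classical_set_scope.
Local Open Scope ring_scope.

(** * Coordinate projections and their chain rule *)

Section Subvector.
Variables (R : realType) (n : nat) (S : {set 'I_n}).

Lemma subtx_is_linear : linear (@subtx R n S).
Proof.
by move=> a [s x] [t y]; congr pair; apply/rowP => i; rewrite !mxE.
Qed.

HB.instance Definition _ :=
  GRing.isLinear.Build R (R * 'rV[R]_n)%type (R * 'rV[R]_#|S|)%type _
    (@subtx R n S) subtx_is_linear.

Lemma subvec_continuous : continuous (@subvec R n S).
Proof.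
(* Entries of a subvector are entries of the full vector, so in the entrywise metric the same radius
   [e] works. *)
move=> x B /nbhs_ballP[e e0 eB]; apply/nbhs_ballP; exists e => // y [_ xy].
by apply: eB; split=> // i j; rewrite !mxE; exact: xy.
Qed.

Lemma subtx_continuous : continuous (@subtx R n S).
Proof.
move=> z; apply: (@cvg_pair _ _ _ (nbhs z) (nbhs z.1) (nbhs (subvec S z.2)) _ _ _
  fst (fun y => subvec S y.2)); first exact: cvg_fst.
by apply: (@cvg_comp _ _ _ snd (@subvec R n S) _ (nbhs z.2));
  [exact: cvg_snd | exact: subvec_continuous].
Qed.

Lemma differentiable_comp_subtx (w : R * 'rV[R]_#|S| -> R) z :
  differentiable w (subtx S z) -> differentiable (w \o subtx S) z.
Proof.
apply: differentiable_comp; apply: linear_differentiable.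
exact: subtx_continuous.
Qed.

(** [subtx S] is linear and continuous, hence its own differential; the chain rule merely moves the
    direction [h] through it. *)
Lemma derive_comp_subtx (w : R * 'rV[R]_#|S| -> R) z h :
  differentiable w (subtx S z) ->
  'D_h (w \o subtx S) z = 'D_(subtx S h) w (subtx S z).
Proof.
move=> dw; rewrite !deriveE //; last exact: differentiable_comp_subtx.
rewrite diff_comp //=; last first.
  by apply: linear_differentiable; exact: subtx_continuous.
by rewrite diff_lin //; exact: subtx_continuous.
Qed.

End Subvector.

(** * The transport operator as a total differential *)

Section Transport.
Variables (R : realType) (p : nat).
Implicit Types (v w : R * 'rV[R]_p -> R) (z : R * 'rV[R]_p) (y : 'rV[R]_p).

(** Expand [(1, y)] along the coordinate directions and use linearity of the differential. The
    algebra of [transport] below is then inherited from ['d v z]. *)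
Lemma transportE v z y :
  differentiable v z -> transport v z y = 'd v z (1, y).
Proof.
move=> dv; rewrite /transport /dt deriveE // mxE.
have -> : (1, y) = (1, 0) + \sum_i y 0 i *: ((0, delta_mx 0 i) : R * 'rV[R]_p).
  apply/eqP; rewrite -pair_eqE /pair_eq /=.
  rewrite (raddf_sum (@fst R 'rV[R]_p)) (raddf_sum (@snd R 'rV[R]_p)) /=.
  rewrite add0r -row_sum_delta eqxx andbT.
  by rewrite big1 ?addr0// => i _; rewrite scaler0.
rewrite linearD linear_sum; congr (_ + _); apply: eq_bigr => i _.
by rewrite linearZ !mxE deriveE // mulrC.
Qed.

Lemma transportB v w z y : differentiable v z -> differentiable w z ->
  transport (v - w) z y = transport v z y - transport w z y.
Proof.
by move=> dv dw; rewrite !transportE ?diffB //; exact: differentiableB.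
Qed.

Lemma transport_sum K (v : 'I_K -> R * 'rV[R]_p -> R) z y :
  (forall k, differentiable (v k) z) ->
  transport (\sum_k v k) z y = \sum_k transport (v k) z y.
Proof.
move=> dv; have dsv := differentiable_sum dv.
rewrite transportE // -deriveE // derive_sum; last first.
  by move=> k; exact: diff_derivable.
by apply: eq_bigr => k _; rewrite transportE // deriveE.
Qed.

End Transport.

(** The projection sends the direction [(1, y)] to [(1, subvec S y)], so only the velocity
    components in [S] act on a function of the projected variables. *)
Lemma transport_comp_subtx (R : realType) (n : nat) (S : {set 'I_n})
    (w : R * 'rV[R]_#|S| -> R) (z : R * 'rV[R]_n) (y : 'rV[R]_n) :
  differentiable w (subtx S z) ->
  transport (w \o subtx S) z y = transport w (subtx S z) (subvec S y).
Proof.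
move=> dw; have dws := differentiable_comp_subtx dw.
by rewrite !transportE // -(deriveE _ dws) -(deriveE _ dw) derive_comp_subtx.
Qed.

(** * Closure properties of C^1 functions *)

Section C1Theory.
Variables (R : realType) (p : nat).
Implicit Types (D : set (R * 'rV[R]_p)) (v w : R * 'rV[R]_p -> R).

Lemma C1_on_differentiable D v z : C1_on D v -> D z -> differentiable v z.
Proof. by move=> [V [_ DV dv _]] /DV; exact: dv. Qed.

Lemma C1_on_cst D (c : R) : C1_on D (cst c).
Proof.
exists setT; split=> // [|h z _].
  exact: openT.
rewrite (_ : (fun y => _) = cst 0); first exact: cvg_cst.
by apply/funext => y; rewrite derive_cst.
Qed.

Lemma C1_on_fst D : C1_on D fst.
Proof.
have cfst : continuous (@fst R 'rV[R]_p) by move=> z; exact: cvg_fst.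
have dfst z : differentiable (@fst R 'rV[R]_p) z.
  exact: linear_differentiable.
exists setT; split=> // [|h z _].
  exact: openT.
rewrite (_ : (fun y => _) = cst h.1); first exact: cvg_cst.
by apply/funext => y; rewrite deriveE // diff_lin.
Qed.

Lemma C1_onD D v w : C1_on D v -> C1_on D w -> C1_on D (v + w).
Proof.
move=> [V [oV DV dv cv]] [V' [oV' DV' dw cw]].
exists (V `&` V'); split; [exact: openI | | | ].
- by move=> z Dz; split; [exact: DV | exact: DV'].
- by move=> z [Vz V'z]; apply: differentiableD; [exact: dv | exact: dw].
move=> h z [Vz V'z].
(* Additivity of the derivative is known only on the common neighbourhood; as that set is open,
   agreement there is enough for continuity at [z]. *)
have eqD y : (V `&` V') y -> 'D_h v y + 'D_h w y = 'D_h (v + w) y.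
  by move=> [Vy V'y]; rewrite deriveD//; apply: diff_derivable;
    [exact: dv | exact: dw].
have cvw : 'D_h v y + 'D_h w y @[y --> z] --> 'D_h v z + 'D_h w z.
  by apply: cvgD; [exact: cv Vz | exact: cw V'z].
rewrite /prop_for /continuous_at /= -(eqD z) //; apply: cvg_trans cvw.
apply: near_eq_cvg; apply: (@filterS _ (nbhs z) _ (V `&` V')); first exact: eqD.
by apply: open_nbhs_nbhs; split => //; exact: openI.
Qed.

Lemma C1_on_sum D K (v : 'I_K -> R * 'rV[R]_p -> R) :
  (forall k, C1_on D (v k)) -> C1_on D (\sum_k v k).
Proof.
move=> Cv; apply: big_ind => //; first exact: (C1_on_cst D 0).
exact: C1_onD.
Qed.

(** The preimage of a neighbourhood is the new neighbourhood; on it the derivative along [h] is the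
    one of [w] along [subtx S h], composed with the continuous projection. *)
Lemma C1_on_comp_subtx (S : {set 'I_p}) (D : set (R * 'rV[R]_#|S|))
    (w : R * 'rV[R]_#|S| -> R) :
  C1_on D w -> C1_on (subtx S @^-1` D) (w \o subtx S).
Proof.
move=> [V [oV DV dw cw]].
have oV' : open (subtx S @^-1` V).
  by apply: open_comp => // z _; exact: subtx_continuous.
exists (subtx S @^-1` V); split => //.
- by move=> z; exact: DV.
- by move=> z Vz; apply: differentiable_comp_subtx; exact: dw.
move=> h z Vz; rewrite /prop_for /continuous_at /= derive_comp_subtx; last exact: dw.
apply: cvg_trans; last first.
  apply: (@cvg_comp _ _ _ (subtx S) ('D_(subtx S h) w)); last exact: cw.
  exact: subtx_continuous.
apply: near_eq_cvg; apply: (@filterS _ (nbhs z) _ (subtx S @^-1` V)).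
  by move=> y Vy; rewrite derive_comp_subtx //; exact: dw.
exact: open_nbhs_nbhs.
Qed.

End C1Theory.

(** [A] and the whole space have the same trace on [A], so this holds even when [A] is not Borel in
    [V]. *)
Lemma measurable_borel_on (R : realType) (V : normedModType R) (A : set V) :
  measurable (A : set (borel_on A)).
Proof.
apply/borel_onP; exists setT; last by rewrite setIT setIid.
by apply: sub_sigma_algebra; exact: openT.
Qed.

(** * Real-valued integrals against a finite measure *)

Section FiniteMeasure.
Context d (Y : measurableType d) (R : realType).
Variables (mu : {finite_measure set Y -> \bar R}) (D : set Y).
Hypothesis mD : measurable D.

Lemma finite_measureE : mu D = (fine (mu D))%:E.
Proof. by rewrite fineK //; exact: fin_num_measure. Qed.

Lemma integral_EFin (h : Y -> R) : mu.-integrable D (EFin \o h) ->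
  (\int[mu]_(y in D) (h y)%:E = (\int[mu]_(y in D) h y)%R%:E)%E.
Proof. by move=> ih; rewrite /Rintegral fineK //; exact: integrable_fin_num. Qed.

(** Used for both relaxed dual inequalities: a pointwise slack [c] costs [c] times the mass once
    integrated. *)
Lemma Rintegral_ge_lower_bound (h l : Y -> R) (c : R) :
  mu.-integrable D (EFin \o h) -> mu.-integrable D (EFin \o l) ->
  (forall y, D y -> l y - c <= h y) ->
  \int[mu]_(y in D) l y - c * fine (mu D) <= \int[mu]_(y in D) h y.
Proof.
move=> ih il lh; have ic := finite_measure_integrable_cst mu c mD.
rewrite -Rintegral_cst // -RintegralB //; apply: le_Rintegral => //.
exact: (integrableB mD il ic).
Qed.

End FiniteMeasure.

(** * Weak duality for the occupation-measure LP *)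

Section WeakDuality.
Variables (R : realType) (n m : nat) (t0 T : R).
Variables (X : set 'rV[R]_n) (U : set 'rV[R]_m).
Variables (f : R * 'rV[R]_n * 'rV[R]_m -> 'rV[R]_n).
Variables (ell : R * 'rV[R]_n * 'rV[R]_m -> R) (g : 'rV[R]_n -> R).
Variable mu0 : {finite_measure set (borel_on X) -> \bar R}.
Hypothesis mu0_int : forall v : R * 'rV[R]_n -> R, C1_on (timeX t0 T X) v ->
  mu0.-integrable X (fun x => (v (t0, x))%:E).

Local Notation Z := (Zset t0 T X U).

Section Feasible.
Variables (mu : {finite_measure set (borel_on Z) -> \bar R}).
Variables (muT : {finite_measure set (borel_on X) -> \bar R}).
Hypothesis feas : OM_feasible f ell g mu0 mu muT.

Let mX : measurable (X : set (borel_on X)) := @measurable_borel_on _ _ X.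
Let mZ : measurable (Z : set (borel_on Z)) := @measurable_borel_on _ _ Z.

Lemma OM_feasible_Rintegral (v : R * 'rV[R]_n -> R) : C1_on (timeX t0 T X) v ->
  \int[muT]_(x in X) v (T, x) - \int[mu0]_(x in X) v (t0, x)
  = \int[mu]_(z in Z) Lie f v z.
Proof.
move=> Cv; have [_ _ _ /(_ v Cv)[iL iT]] := feas.
(* Feasibility gives integrability for [mu] and [muT]; for [mu0] it comes from [mu0_int].
   Injectivity of [EFin] then gives the equation in the reals. *)
by rewrite !integral_EFin //; [move=> [] | exact: mu0_int].
Qed.

(** Testing with [v = 1] makes the right-hand side of the Liouville equation vanish. *)
Lemma OM_feasible_mass_final : fine (muT X) = fine (mu0 X).
Proof.
have := OM_feasible_Rintegral (C1_on_cst _ 1).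
rewrite !Rintegral_cst // (_ : Lie f _ = cst 0); last first.
  apply/funext => z; rewrite /Lie transportE; last exact: differentiable_cst.
  by rewrite diff_cst.
by rewrite Rintegral_cst // mul0r !mul1r => /subr0_eq.
Qed.

(** Testing with [v = t], for which [Lie f v = 1], equates the mass of [mu] with
    [T * muT(X) - t0 * mu0(X)]; conservation of mass concludes. *)
Lemma OM_feasible_mass : fine (mu Z) = (T - t0) * fine (mu0 X).
Proof.
have := OM_feasible_Rintegral (C1_on_fst _).
rewrite !Rintegral_cst // (_ : Lie f _ = cst 1); last first.
  have dfst z : differentiable (@fst R 'rV[R]_n) z.
    exact: C1_on_differentiable (C1_on_fst setT) _.
  apply/funext => z; rewrite /Lie transportE // diff_lin //.
  by move=> y; exact: cvg_fst.
by rewrite Rintegral_cst // OM_feasible_mass_final mul1r mulrBl.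
Qed.

End Feasible.

Lemma dual_feasible_le_OM_value (eps epsT : R) (v : R * 'rV[R]_n -> R) :
  dual_feasible t0 T X U f ell g eps epsT v ->
  (\int[mu0]_(x in X) (v (t0, x))%:E - (T - t0)%:E * mu0 X * eps%:E
     - mu0 X * epsT%:E <= OM_value t0 T U f ell g mu0)%E.
Proof.
move=> [Cv v_run v_end]; apply: le_ereal_inf_tmp => _ [mu [muT [feas ->]]].
have mX := @measurable_borel_on _ _ X; have mZ := @measurable_borel_on _ _ Z.
have [_ iell ig /(_ v Cv)[iL iT _]] := feas.
have i0 := mu0_int Cv.
rewrite finite_measureE // !integral_EFin // -!EFinM -!EFinB -EFinD lee_fin.
have := OM_feasible_Rintegral feas Cv.
(* The running inequality is read as [ell >= - Lie f v - eps]; writing the sign as a scalar factor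
   lets it be pulled out of the integral. *)
have iNL : mu.-integrable Z (EFin \o (fun z => -1 * Lie f v z)).
  exact: (integrableZl mZ (-1) iL).
have := Rintegral_ge_lower_bound (c := eps) mZ iell iNL.
rewrite RintegralZl //.
have := Rintegral_ge_lower_bound (c := epsT) mX ig iT.
rewrite (OM_feasible_mass feas) (OM_feasible_mass_final feas).
have endP y : X y -> v (T, y) - epsT <= g y by move=> /v_end; lra.
have runP z : Z z -> -1 * Lie f v z - eps <= ell z by move=> /v_run; lra.
(* Adding the two bounds, [balance] replaces the terminal integral minus the integral of [Lie f v]
   by the pairing of [v] at [t0] with [mu0]. *)
move=> /(_ endP) le_end /(_ runP) le_run balance; lra.
Qed.

End WeakDuality.

(** * Block-additive functions and their coefficients *)

Section Blocks.
Variables (R : realType) (n m K : nat) (t0 T : R).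
Variables (X : set 'rV[R]_n) (U : set 'rV[R]_m).
Variables (S N : 'I_K -> {set 'I_n}) (M : 'I_K -> {set 'I_m}).
Variable f : R * 'rV[R]_n * 'rV[R]_m -> 'rV[R]_n.
Variable fb : forall k : 'I_K,
  R * 'rV[R]_#|N k| * 'rV[R]_#|M k| -> 'rV[R]_#|S k|.
Hypothesis f_sep : forall k z, Zset t0 T X U z ->
  subvec (S k) (f z) = @fb k (subtxu (N k) (M k) z).
Implicit Types v w : forall k : 'I_K, R * 'rV[R]_#|S k| -> R.

Lemma block_sumE v : block_sum v = \sum_k (v k \o subtx (S k)).
Proof. by apply/funext => z; rewrite fct_sumE. Qed.

Lemma timeX_subtx k z :
  timeX t0 T X z -> timeX t0 T (subvec (S k) @` X) (subtx (S k) z).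
Proof. by move=> [tz Xz]; split => //; exists z.2. Qed.

Lemma C1_on_block_sum v :
  (forall k, C1_on (timeX t0 T (subvec (S k) @` X)) (v k)) ->
  C1_on (timeX t0 T X) (block_sum v).
Proof.
move=> Cv; rewrite block_sumE; apply: C1_on_sum => k.
have [V [oV DV dV cV]] := C1_on_comp_subtx (Cv k).
by exists V; split => // z /(timeX_subtx k) /DV.
Qed.

(** The chain rule gives each block the velocity [subvec (S k) (f z)], which [f_sep] identifies with
    [fb k] on the domain. *)
Lemma Lie_block_sum v z :
  (forall k, C1_on (timeX t0 T (subvec (S k) @` X)) (v k)) ->
  Zset t0 T X U z ->
  Lie f (block_sum v) z = \sum_k block_op (@fb) (v k) z.
Proof.
move=> Cv Zz; have dv k : differentiable (v k) (subtx (S k) z.1).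
  by apply: C1_on_differentiable (Cv k) _; apply: timeX_subtx; case: Zz.
rewrite /Lie block_sumE transport_sum => [|k]; last first.
  exact: differentiable_comp_subtx.
by apply: eq_bigr => k _; rewrite transport_comp_subtx // f_sep.
Qed.

Lemma block_opB (k : 'I_K) (v w : R * 'rV[R]_#|S k| -> R) z :
  C1_on (timeX t0 T (subvec (S k) @` X)) v ->
  C1_on (timeX t0 T (subvec (S k) @` X)) w ->
  Zset t0 T X U z ->
  block_op (@fb) (fun y => v y - w y) z = block_op (@fb) v z - block_op (@fb) w z.
Proof.
move=> Cv Cw [/(timeX_subtx k) Dz _].
by rewrite /block_op -transportB //; apply: C1_on_differentiable Dz.
Qed.

Lemma range_sum_par
    (par : forall (k : 'I_K) (r : nat), 'rV[R]_r -> R * 'rV[R]_#|S k| -> R)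
    (r : 'I_K -> nat) v :
  (forall k, range (par k (r k)) (v k)) ->
  range (sum_par par (r := r)) (block_sum v).
Proof.
(* One coefficient row is chosen per block; their concatenation is the witness, and [mxrowK]
   recovers each block. *)
move=> vP; pose c k := projT1 (cid2 (vP k)).
exists (\mxrow_k c k) => //; apply/funext => z; apply: eq_bigr => k _.
by rewrite mxrowK /c; case: cid2 => /= ? _ ->.
Qed.

End Blocks.

Lemma ereal_sup_norm_le (R : realType) (Y : Type) (D : set Y) (h : Y -> R) eta :
  (ereal_sup [set `|h y|%:E | y in D] <= eta%:E)%E ->
  forall y, D y -> - eta <= h y <= eta.
Proof.
move=> supD y Dy; rewrite -ler_norml -lee_fin; apply: le_trans supD.
by apply: ereal_sup_ubound; exists y.
Qed.

Lemma sum_ord_le_const (R : realType) (K : nat) (F : 'I_K -> R) (eta : R) :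
  (forall k, F k <= eta) -> \sum_k F k <= K%:R * eta.
Proof.
move=> F_le; apply: (le_trans (ler_sum _ (fun k _ => F_le k))).
by rewrite sumr_const card_ord mulr_natl.
Qed.

Theorem corollary2
  (R : realType) (n m K : nat) (t0 T : R) (lt_t0T : t0 < T)
  (X : set 'rV[R]_n) (U : set 'rV[R]_m)
  (f : R * 'rV[R]_n * 'rV[R]_m -> 'rV[R]_n)
  (ell : R * 'rV[R]_n * 'rV[R]_m -> R) (g : 'rV[R]_n -> R)
  (mu0 : {finite_measure set (borel_on X) -> \bar R})
  (mu0_conc : concentrated mu0)
  (mu0_int : forall v : R * 'rV[R]_n -> R, C1_on (timeX t0 T X) v ->
    mu0.-integrable X (fun x => (v (t0, x))%:E))
  (S N : 'I_K -> {set 'I_n}) (M : 'I_K -> {set 'I_m})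
  (sub_SN : forall k, S k \subset N k)
  (ellb : forall k : 'I_K, R * 'rV[R]_#|N k| * 'rV[R]_#|M k| -> R)
  (fb : forall k : 'I_K,
    R * 'rV[R]_#|N k| * 'rV[R]_#|M k| -> 'rV[R]_#|S k|)
  (ell_sep : forall z, Zset t0 T X U z ->
    ell z = \sum_(k < K) ellb k (subtxu (N k) (M k) z))
  (f_sep : forall k z, Zset t0 T X U z ->
    subvec (S k) (f z) = fb k (subtxu (N k) (M k) z))
  (vstar : forall k : 'I_K, R * 'rV[R]_#|S k| -> R)
  (vstar_C1 : forall k, C1_on (timeX t0 T (subvec (S k) @` X)) (vstar k))
  (vstar_cert : dual_certificate t0 T X U f ell g (block_sum vstar))
  (par : forall (k : 'I_K) (r : nat), 'rV[R]_r -> R * 'rV[R]_#|S k| -> R)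
  (par_C1 : forall k r (c : 'rV[R]_r),
    C1_on (timeX t0 T (subvec (S k) @` X)) (par k r c))
  (r : 'I_K -> R -> nat)
  (vt : R -> forall k : 'I_K, R * 'rV[R]_#|S k| -> R)
  (vt_approx : forall eta : R, 0 < eta -> forall k : 'I_K,
    [/\ range (par k (r k eta)) (vt eta k),
        (ereal_sup [set `|block_op fb (fun z => vt eta k z - vstar k z) z|%:E
                   | z in Zset t0 T X U] <= eta%:E)%E &
        (ereal_sup [set `|vt eta k (T, y) - vstar k (T, y)|%:E
                   | y in subvec (S k) @` X] <= eta%:E)%E]) :
  forall eta : R, 0 < eta ->
    [/\ dual_feasible t0 T X U f ell g (K%:R * eta) (K%:R * eta)
          (block_sum (vt eta)),
        (\int[mu0]_(x in X) (block_sum (vt eta) (t0, x))%:E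
           - (T - t0)%:E * mu0 X * (K%:R * eta)%:E
           - mu0 X * (K%:R * eta)%:E
         <= OM_value t0 T U f ell g mu0)%E &
        range (sum_par par (r := fun k => r k eta)) (block_sum (vt eta))].
Proof.
move=> eta eta_gt0.
have vt_C1 k : C1_on (timeX t0 T (subvec (S k) @` X)) (vt eta k).
  by have [[c _ <-] _ _] := vt_approx eta eta_gt0 k; exact: par_C1.
have feas : dual_feasible t0 T X U f ell g (K%:R * eta) (K%:R * eta)
    (block_sum (vt eta)).
  have [_ star_run star_end] := vstar_cert.
  split=> [|z Zz|x Xx]; first exact: C1_on_block_sum.
  (* Replacing [vstar] by [vt eta] lowers [ell + Lie] by exactly this sum; each term is bounded by
     the lower half of the two-sided estimate. *)
  - have : \sum_k (block_op fb (vstar k) z - block_op fb (vt eta k) z)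
        <= K%:R * eta.
      apply: sum_ord_le_const => k.
      have [_ /ereal_sup_norm_le /(_ z Zz) + _] := vt_approx eta eta_gt0 k.
      by rewrite (block_opB _ (vt_C1 k) (vstar_C1 k) Zz); lra.
    rewrite sumrB -!(Lie_block_sum f_sep) //.
    by have := star_run z Zz; lra.
  (* At the terminal time [v] enters with a minus sign, so here the upper half of the estimate is
     used. *)
  - have : block_sum (vt eta) (T, x) - block_sum vstar (T, x) <= K%:R * eta.
      rewrite /block_sum -sumrB; apply: sum_ord_le_const => k.
      have [_ _ /ereal_sup_norm_le /(_ (subvec (S k) x))] :=
        vt_approx eta eta_gt0 k.
      by case/(_ _)/andP => //; exists x.
    by have := star_end x Xx; lra.
split=> //; first exact: dual_feasible_le_OM_value feas.
by apply: range_sum_par => k; have [] := vt_approx eta eta_gt0 k.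
Qed.
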